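(* Let $s\in[s_{\min},s_{\max}]\subset(0,1)$, $\delta\in(0,\infty)$, and let $\eta>0$. Assume that $u=u(s)\in H^{s+1/2-\varepsilon}_\Omega(\mathbb{R}^n)$, $\varepsilon>0$. For some $\xi\in(\tfrac1{10},\tfrac12)$ define the subintervals $\mathcal{S}_k=[s_{\min,k},s_{\max,k}]$, $1\le k\le K$, by $$s_{\min,1}=s_{\min},\quad s_{\max,K}=s_{\max},\quad s_{\min,k}=s_{\max,k-1}\ (2\le k\le K),$$ $$s_{\max,k}=s_{\min,k}+\left(\tfrac12-\xi\right)g_k\ (1\le k\le K-1),\quad g_k:=\min\{1-s_{\min,k},\tfrac12\}-\varepsilon.$$ Furthermore, for $s\in\mathcal{S}_k$ set the interpolation order to $$M_k=\left\lceil\frac{\log(\eta/C_k(\delta))}{\log\left(\frac18(\xi^{-1}-2)\right)}\right\rceil-1 .$$ Let $\overline{s}_2(s):=\min\{1,s_{\min,k}+\tfrac12\}-\varepsilon$ for $s\in\mathcal{S}_k$. Then, for $s\in\mathcal{S}_k$ and $v\in H^s_\Omega(\mathbb{R}^n)$, $$|a(u(s),v;s,\delta)-\tilde a(u(s),v;s,\delta)|\le\eta\,\|u(s)\|_{H^{\overline{s}_2(s)}_\Omega(\mathbb{R}^n)}\|v\|_{H^s_\Omega(\mathbb{R}^n)},$$ where the total number of interpolation nodes satisfies $$\sum_{k=1}^K(M_k+1)\le C|\log\eta|,$$ and the constant $C$ depends on $\xi$, $\delta$ and $s_{\max}$.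
   Context: $\Omega\subset\mathbb{R}^n$, $n\ge1$, is a bounded domain with $C^\infty$ boundary. $H^t_\Omega(\mathbb{R}^n)=\{v\in H^t(\mathbb{R}^n): v=0\text{ on }\mathbb{R}^n\setminus\Omega\}$, endowed with the seminorm of $H^t(\mathbb{R}^n)$ as norm. The bilinear form is $$a(u,v;s,\delta)=\iint_{\{(x,y)\in\mathbb{R}^{2n}:|x-y|\le\delta\}}\frac{(u(x)-u(y))(v(x)-v(y))}{|x-y|^{n+2s}}\,dy\,dx .$$ The intervals $\mathcal{S}_1,\dots,\mathcal{S}_K$ subdivide $[s_{\min},s_{\max}]$; $K$ is the first index at which the recursive right endpoint $s_{\min,k}+(\frac12-\xi)g_k$ reaches or exceeds $s_{\max}$ (the last interval is cut off at $s_{\max}$). The interpolated form is, for $s\in\mathcal{S}_k$, $$\tilde a(u,v;s,\delta)=\sum_{m=0}^{M_k}\Theta_{\mathcal{S}_k,m}(s)\,a(u,v;s_m,\delta),$$ where $s_0,\dots,s_{M_k}$ are the Chebyshev nodes on $\mathcal{S}_k$ (affine images of the Chebyshev points $\cos(m\pi/M_k)$, $0\le m\le M_k$, of $[-1,1]$) and $\Theta_{\mathcal{S}_k,m}$ are the corresponding Lagrange polynomials. The constant is $C_k(\delta)=4(e^{-1}+\delta^{g_k+1})$ if $\delta>1$ and $C_k(\delta)=4e^{-1}$ if $\delta\le1$.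
   Formalization: The node bound fails at η=1 and uniformly as ε→min{1−s_max,1/2}; it is proved for |log η|≥λ and ε≤ε₀, for any λ>0 and ε₀<min{1−s_max,1/2}, with C depending also on λ and ε₀; s_min<s_max is assumed. *)

(* Defs.v *)
From HB Require Import structures.
From mathcomp Require Import all_boot all_order all_algebra.
From mathcomp Require Import all_classical all_reals all_analysis.

Set Implicit Arguments.
Unset Strict Implicit.
Unset Printing Implicit Defensive.

Import Order.TTheory GRing.Theory Num.Theory.
Import numFieldNormedType.Exports.

Local Open Scope classical_set_scope.
Local Open Scope ring_scope.

(* Vectors of R^n are row vectors.  The library's norm on 'rV[R]_n is the sup
   norm, which gives the usual topology; every |x - y| below is [enorm]. *)

Definition rV_display : measure_display -> measure_display.
Proof. exact. Qed.

Section rV_measurable.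
Context (R : realType) (n : nat).

Definition rV_coord (i : 'I_n) (x : 'rV[R]_n) : measurableTypeR R := x ord0 i.

Let rV_set0 : g_sigma_preimage rV_coord set0.
Proof. exact: sigma_algebra0. Qed.

Let rV_setC A : g_sigma_preimage rV_coord A ->
  g_sigma_preimage rV_coord (~` A).
Proof. exact: sigma_algebraC. Qed.

Let rV_bigcup (F : (set 'rV[R]_n)^nat) :
  (forall i, g_sigma_preimage rV_coord (F i)) ->
  g_sigma_preimage rV_coord (\bigcup_i (F i)).
Proof. exact: sigma_algebra_bigcup. Qed.

(* The sigma-algebra generated by the coordinates is the Borel one. *)
HB.instance Definition _ := @isMeasurable.Build (rV_display R.-ocitv.-measurable.-sigma)
  'rV[R]_n (g_sigma_preimage rV_coord) rV_set0 rV_setC rV_bigcup.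

Lemma measurable_rV_coord i : measurable_fun [set: 'rV[R]_n] (rV_coord i).
Proof.
move=> _ Y mY; rewrite setTI; apply: sub_sigma_algebra => /=.
rewrite -bigcup_seq/=; exists i => /=; first by rewrite mem_index_enum.
by exists Y => //; rewrite setTI.
Qed.

Lemma measurable_fun_rVP d (T : measurableType d) (f : T -> 'rV[R]_n) :
  (forall i, measurable_fun [set: T] (rV_coord i \o f)) ->
  measurable_fun [set: T] f.
Proof.
move=> mf _ A mA; rewrite setTI.
suff: preimage_set_system [set: T] f (g_sigma_preimage rV_coord) `<=` measurable.
  by apply; exists A => //; rewrite setTI.
rewrite -g_sigma_preimage_comp.
apply: smallest_sub; first exact: sigma_algebra_measurable.
rewrite -bigcup_seq; apply: bigcup_sub => i _ _ [B mB <-].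
exact: mf.
Qed.

End rV_measurable.

Section rV_cons.
Context (R : realType) (n : nat).

Definition rV_cons (p : measurableTypeR R * 'rV[R]_n) : 'rV[R]_n.+1 :=
  @row_mx R 1 1 n p.1%:M p.2.

Definition rV_uncons (x : 'rV[R]_n.+1) : measurableTypeR R * 'rV[R]_n :=
  (x ord0 ord0, @rsubmx R 1 1 n x).

Lemma rV_consK : cancel rV_cons rV_uncons.
Proof.
move=> [a x]; rewrite /rV_uncons /rV_cons row_mxKr; congr (_, _).
have -> : ord0 = @lshift 1 n ord0 by exact: val_inj.
by rewrite (@row_mxEl R 1 1 n) mxE eqxx mulr1n.
Qed.

Lemma measurable_rV_cons : measurable_fun setT rV_cons.
Proof.
apply: measurable_fun_rVP => i.
case: (split_ordP (m := 1) i) => j ->.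
- rewrite (_ : _ \o _ = fst) //; apply/funext => -[a x] /=.
  by rewrite /rV_coord /rV_cons (@row_mxEl R 1 1 n) mxE !ord1 eqxx mulr1n.
- rewrite (_ : _ \o _ = rV_coord j \o snd); last first.
    by apply/funext => -[a x] /=; rewrite /rV_coord /rV_cons (@row_mxEr R 1 1 n).
  by apply: measurableT_comp => //; exact: measurable_rV_coord.
Qed.

Lemma measurable_rV_uncons : measurable_fun setT rV_uncons.
Proof.
apply: measurable_fun_pair; first exact: measurable_rV_coord.
apply: measurable_fun_rVP => i.
rewrite (_ : _ \o _ = @rV_coord R n.+1 (@rshift 1 n i)).
  exact: measurable_rV_coord.
by apply/funext => x; rewrite /rV_coord /= mxE.
Qed.

Variable mu : {sigma_finite_measure set 'rV[R]_n -> \bar R}.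

Definition leb_cons : set 'rV[R]_n.+1 -> \bar R :=
  pushforward (@lebesgue_measure R \x mu)%E rV_cons.

Let leb_cons0 : leb_cons set0 = 0%E.
Proof. by rewrite /leb_cons /pushforward preimage_set0 measure0. Qed.

Let leb_cons_ge0 A : (0 <= leb_cons A)%E.
Proof. by rewrite /leb_cons /pushforward; apply: measure_ge0. Qed.

Let leb_cons_additive : semi_sigma_additive leb_cons.
Proof.
move=> F mF tF mUF; rewrite /leb_cons /pushforward preimage_bigcup.
apply: measure_semi_sigma_additive.
- by move=> k; rewrite -[X in measurable X]setTI; exact: measurable_rV_cons.
- apply/trivIsetP => /= i j _ _ ij; rewrite -preimage_setI.
  by move/trivIsetP : tF => /(_ _ _ _ _ ij) ->//; rewrite preimage_set0.
- rewrite -preimage_bigcup -[X in measurable X]setTI.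
  exact: measurable_rV_cons.
Qed.

HB.instance Definition _ := isMeasure.Build _ _ _ leb_cons
  leb_cons0 leb_cons_ge0 leb_cons_additive.

Let leb_cons_sigma_finite : sigma_finite setT leb_cons.
Proof.
have /sigma_finiteP[F [TF ndF Foo]] := sigma_finiteT (@lebesgue_measure R).
have /sigma_finiteP[G [TG ndG Goo]] := sigma_finiteT mu.
exists (fun k => rV_uncons @^-1` (F k `*` G k)).
  rewrite -preimage_bigcup -[LHS](preimage_setT rV_uncons); congr (_ @^-1` _).
  rewrite -setXTT TF TG predeqE => -[x y]; split.
    move=> [/= [k _ Fkx] [l _ Gly]]; exists (maxn k l) => //; split.
    - by move: x Fkx; exact/subsetPset/ndF/leq_maxl.
    - by move: y Gly; exact/subsetPset/ndG/leq_maxr.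
  by move=> [k _ []/= ? ?]; split; exists k.
move=> k; have [mF Fk] := Foo k; have [mG Gk] := Goo k.
split.
  rewrite -[X in measurable X]setTI; apply: measurable_rV_uncons => //.
  exact: measurableX.
rewrite /leb_cons /pushforward -comp_preimage.
rewrite (_ : _ \o _ = id); last by apply/funext => p /=; rewrite rV_consK.
by rewrite preimage_id product_measure1E// lte_mul_pinfty// ge0_fin_numE.
Qed.

HB.instance Definition _ := Measure_isSigmaFinite.Build _ _ _ leb_cons
  leb_cons_sigma_finite.

End rV_cons.

(* Lebesgue measure on R^n, as the image of lebesgue_measure \x leb R (n - 1). *)
Fixpoint leb (R : realType) (n : nat) :
    {sigma_finite_measure set 'rV[R]_n -> \bar R} :=
  match n with
  | 0 => \d_ (0 : 'rV[R]_0)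
  | n'.+1 => leb_cons (leb R n')
  end.

Section smooth.
Context (R : realType) (n : nat).
Implicit Types (f v w : 'rV[R]_n -> R) (x : 'rV[R]_n).

Definition enorm x : R := Num.sqrt (\sum_i x ord0 i ^+ 2).

Definition partial (i : 'I_n) f : 'rV[R]_n -> R :=
  fun x => derive f x (delta_mx ord0 i).

Fixpoint is_Ck (k : nat) f : Prop :=
  continuous f /\
  match k with
  | 0 => True
  | k'.+1 => forall i, (forall x, derivable f x (delta_mx ord0 i)) /\
                       is_Ck k' (partial i f)
  end.

Definition smooth f : Prop := forall k, is_Ck k f.

Definition test_function f : Prop :=
  smooth f /\ compact (closure [set x | f x != 0]).

End smooth.

Section domains.
Context (R : realType) (n : nat).

(* Near each boundary point, and for some choice of a coordinate axis i and of
   an orientation b, Omega is the strict epigraph of a smooth function gamma of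
   the remaining coordinates. *)
Definition smooth_boundary (Omega : set 'rV[R]_n) : Prop :=
  forall x0, closure Omega x0 -> ~ Omega° x0 ->
    exists (r : R) (i : 'I_n) (b : bool) (gamma : 'rV[R]_n.-1 -> R),
      [/\ 0 < r, smooth gamma &
          forall x, enorm (x - x0) < r ->
            (Omega x <-> gamma (col' i x) < (-1) ^+ b * x ord0 i)].

Definition smooth_bounded_domain (Omega : set 'rV[R]_n) : Prop :=
  [/\ open Omega, connected Omega, Omega !=set0, bounded_set Omega &
      smooth_boundary Omega].

End domains.

Section sobolev.
Context (R : realType) (n : nat).
Implicit Types (u v w : 'rV[R]_n -> R).

Definition weak_partial (i : 'I_n) v w : Prop :=
  forall phi, test_function phi ->
    \int[leb R n]_x (v x * partial i phi x) =
    - \int[leb R n]_x (w x * phi x).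

(* The seminorm of H^t(R^n) for 0 < t < 1, with value +oo outside H^t(R^n). *)
Definition gagliardo (t : R) v : \bar R :=
  ((\int[(leb R n \x leb R n)%E]_z
      ((v z.1 - v z.2) ^+ 2 / enorm (z.1 - z.2) `^ (n%:R + 2 * t))%:E)
    `^ 2^-1)%E.

(* H^{m + sigma}(R^n) for a natural number m and 0 <= sigma < 1 *)
Fixpoint sobolev_rec (m : nat) (sigma : R) v : Prop :=
  v \in Lfun (leb R n) 2%:E /\
  match m with
  | 0 => 0 < sigma -> (gagliardo sigma v < +oo)%E
  | m'.+1 => forall i, exists w, weak_partial i v w /\ sobolev_rec m' sigma w
  end.

(* H^t(R^n) for t >= 0; orders t >= 1 do occur, via s + 1/2 - eps. *)
Definition sobolev (t : R) v : Prop :=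
  sobolev_rec (Num.truncn t) (t - (Num.truncn t)%:R) v.

(* Elements are representatives of classes, so v vanishes a.e. off Omega. *)
Definition sobolev_on (Omega : set 'rV[R]_n) (t : R) v : Prop :=
  sobolev t v /\ {ae leb R n, forall x, ~ Omega x -> v x = 0}.

(* a(u, v; s, delta); on the diagonal the integrand is 0 / 0 = 0. *)
Definition nonlocal_form u v (s delta : R) : R :=
  \int[(leb R n \x leb R n)%E]_(z in [set z | enorm (z.1 - z.2) <= delta])
    ((u z.1 - u z.2) * (v z.1 - v z.2) /
     enorm (z.1 - z.2) `^ (n%:R + 2 * s)).

End sobolev.

Section interpolation.
Context (R : realType).

(* For M = 0 the division by zero makes the only node the right endpoint b. *)
Definition cheb_node (a b : R) (M m : nat) : R :=
  (a + b) / 2 + (b - a) / 2 * cos (m%:R * pi / M%:R).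

(* Theta_m(s).  The library's [lagrange] wants nodes that are injective on the
   whole of nat, which the Chebyshev nodes are not. *)
Definition lagrange_val (a b : R) (M m : nat) (s : R) : R :=
  \prod_(j < M.+1 | j != m :> nat)
    ((s - cheb_node a b M j) / (cheb_node a b M m - cheb_node a b M j)).

(* The order M is an integer; the sum over 0 <= m <= M is empty if M < 0. *)
Definition interp_form (n : nat) (a b : R) (M : int) (u v : 'rV[R]_n -> R)
    (s delta : R) : R :=
  match M with
  | Posz M => \sum_(m < M.+1)
      lagrange_val a b M m s * nonlocal_form u v (cheb_node a b M m) delta
  | Negz _ => 0
  end.

End interpolation.

Section subintervals.
Context (R : realType).
Variables (smin smax xi eps : R).

Definition gap (t : R) : R := Num.min (1 - t) (1 / 2) - eps.

Definition next_end (t : R) : R := t + (1 / 2 - xi) * gap t.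

(* The indices k start at 1. *)
Definition s_min (k : nat) : R := iter k.-1 next_end smin.

Definition g_ (k : nat) : R := gap (s_min k).

Definition last_index (K : nat) : Prop :=
  [/\ (1 <= K)%N, smax <= next_end (s_min K) &
      forall k, (1 <= k < K)%N -> next_end (s_min k) < smax].

Definition s_max (K k : nat) : R :=
  if (k < K)%N then next_end (s_min k) else smax.

Definition C_ (delta : R) (k : nat) : R :=
  if 1 < delta then 4 * (expR (- 1) + delta `^ (g_ k + 1)) else 4 * expR (- 1).

Definition interp_order (delta eta : R) (k : nat) : int :=
  Num.ceil (ln (eta / C_ delta k) / ln (1 / 8 * (xi^-1 - 2))) - 1.

Definition s2bar (k : nat) : R := Num.min 1 (s_min k + 1 / 2) - eps.

End subintervals.

(* Main.v *)
Require Import Defs.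
From mathcomp Require Import all_boot all_order all_algebra.
From mathcomp Require Import all_classical all_reals all_analysis.
From mathcomp Require Import measurable_realfun.
From mathcomp Require Import ring lra.

(** The forms depend on s only through the kernel |x-y|^(-n-2s), so that the
    interpolation error of s |-> a(u, v; s, delta) is the integral of
    (u(x)-u(y)) (v(x)-v(y)) |x-y|^-n against the interpolation error of the scalar
    function s |-> r^(-2s) = e^(-2 s ln r) at r = |x-y|. It is therefore enough to
    bound the latter by eta r^-(s2bar+s) for 0 < r <= delta: what remains is
    the product of the two difference quotients whose L^2 norms are the
    seminorms of u and v, and Cauchy-Schwarz concludes ([nonlocal_form_error]).

    The scalar error is the Lagrange remainder of an exponential
    ([lagrange_exp_remainder]), in which the node polynomial is at most
    4 ((b-a)/4)^(M+1) for Chebyshev nodes ([cheb_node_prod_le]). The powers of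
    |ln r| in it are harmless because y^N / N! <= e^(y-1), and because the length of
    S_k, at most (1/2 - xi) g_k, leaves a margin of 2 xi g_k in the exponent of r.
    Half the quotient of (1/2 - xi) g_k by 2 xi g_k is the convergence rate
    (1/xi - 2) / 8 ([interp_kernel_error]), which is less than
    1 because xi > 1/10. The order M_k is the least one for which the rate to the
    power M_k + 1 brings C_k below eta.

    The gaps g_k are bounded below by min(1 - smax, 1/2) - eps0, so that the
    subintervals are bounded in number ([number_subintervals]), and each order
    is at most a multiple of |ln eta| ([interp_order_le]). *)

Set Implicit Arguments.
Unset Strict Implicit.
Unset Printing Implicit Defensive.

Import Order.TTheory GRing.Theory Num.Theory.
Import numFieldNormedType.Exports.

Local Open Scope classical_set_scope.
Local Open Scope ring_scope.

(** * Lagrange interpolation of exponentials *)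

(** Rolle's theorem in the gaps of a strictly increasing list of zeros.
    Keeping the head [x] as a strict lower bound of the new list, and keeping
    all zeros in [a, b], makes the statement iterable. *)
Lemma rolle_path (R : realType) (f df : R -> R) (a b x : R) (r : seq R) :
  (forall t, is_derive t (1:R) f (df t)) ->
  path <%R x r -> {in x :: r, forall t, f t = 0 /\ a <= t <= b} ->
  exists r' : seq R, [/\ size r' = size r, path <%R x r' &
    {in r', forall t, df t = 0 /\ a <= t <= b}].
Proof.
move=> dfP; elim: r x => [|y r IHr] x /=; first by exists [::]; split.
move=> /andP[xy yr] zs.
have [|r' [szr' yr' zr']] := IHr y yr.
  by move=> t tr; apply: zs; rewrite inE tr orbT.
have [fx /andP[ax _]] := zs x (mem_head _ _).
have [fy /andP[_ yb]] := zs y (mem_behead (s := x :: y :: r) (mem_head _ _)).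
have [|||z zxy dz] := @Rolle R f x y xy.
- by move=> t _; have [] := dfP t.
- apply: derivable_within_continuous => t _; by have [] := dfP t.
- by rewrite fx fy.
have dfz : df z = 0.
  have [_ <-] := dfP z; by have [_] := dz.
move: zxy; rewrite in_itv /= => /andP[xz zy].
exists (z :: r'); split => /=.
- by rewrite szr'.
- by rewrite xz; case: r' yr' {szr' zr'} => //= w r' /andP[yw ->]; rewrite (lt_trans zy).
- move=> t; rewrite inE => /predU1P[->|/zr' //]; split => //.
  by rewrite (le_trans ax (ltW xz)) (le_trans (ltW zy) yb).
Qed.

(** Iterating Rolle stays inside the class of functions A e^(ct) - q(t): a
    derivative multiplies A by c and differentiates q. Hence only formal
    derivatives of polynomials are needed, and no higher derivatives of real
    functions. *)
Lemma exp_sub_poly_zeros (R : realType) (a b c A x : R) (q : {poly R})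
    (r : seq R) :
  path <%R x r ->
  {in x :: r, forall t, A * expR (c * t) - q.[t] = 0 /\ a <= t <= b} ->
  exists2 t, a <= t <= b & A * c ^+ size r * expR (c * t) = q^`(size r).[t].
Proof.
move Er: (size r) => N.
elim: N A q x r Er => [|N IHN] A q x r szr.
  move=> _ /(_ x (mem_head _ _))[/eqP]; rewrite subr_eq0 => /eqP Ex xab.
  by exists x => //; rewrite expr0 mulr1 derivn0.
move=> xr zs.
have D t : is_derive t (1:R) (fun t : R => A * expR (c * t) - q.[t])
    (A * c * expR (c * t) - q^`().[t]).
  apply: is_deriveB.
  apply: is_derive_eq; rewrite /GRing.scale /=; ring.
have [r' [szr' xr' zr']] := rolle_path D xr zs.
move: szr'; rewrite szr; case: r' xr' zr' => //= y r' /andP[_ yr'] zr' [szr'].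
have [t tab Et] := IHN _ _ _ _ szr' yr' zr'.
by exists t => //; rewrite -derivnS derivSn -Et exprS mulrA.
Qed.

Lemma derivn_size (R : nzRingType) (q : {poly R}) (N : nat) :
  (size q <= N.+1)%N -> q^`(N) = (q`_N *+ N`!)%:P.
Proof.
move=> szq; apply/polyP => i; rewrite coef_derivn coefC.
case: i => [|i] /=; first by rewrite addn0 ffactnn.
by rewrite nth_default ?mul0rn// (leq_trans szq)// addnS ltnS leq_addr.
Qed.

(** The Lagrange remainder for t |-> e^(ct). Subtracting from the function its
    interpolant p and the multiple kap of the node polynomial W that makes the
    difference vanish at s as well leaves M + 2 zeros, so that the derivative
    of order M + 1, which is c^(M+1) e^(ct) - kap (M + 1)!, vanishes
    somewhere. *)
Lemma lagrange_exp_remainder (R : realType) (x : nat -> R) (M : nat)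
    (a b c s : R) :
  {in gtn M.+1 &, injective x} -> {in gtn M.+1, forall i, a <= x i <= b} ->
  a <= s <= b ->
  exists2 t, a <= t <= b &
    expR (c * s) - \sum_(m < M.+1)
      (\prod_(j < M.+1 | j != m :> nat) ((s - x j) / (x m - x j))) *
        expR (c * x m) =
    c ^+ M.+1 / (M.+1)`!%:R * expR (c * t) * \prod_(j < M.+1) (s - x j).
Proof.
move=> injx xab sab.
pose l (m : 'I_M.+1) : {poly R} :=
  \prod_(j < M.+1 | j != m :> nat) ((x m - x j)^-1 *: ('X - (x j)%:P)).
have lE m t : (l m).[t] =
    \prod_(j < M.+1 | j != m :> nat) ((t - x j) / (x m - x j)).
  rewrite horner_prod; apply: eq_bigr => j _.
  by rewrite hornerZ hornerXsubC mulrC.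
have lx m (i : 'I_M.+1) : (l m).[x i] = (i == m)%:R.
  rewrite lE; case: eqVneq => [->|im].
    rewrite big1// => j jm; rewrite divff// subr_eq0.
    by apply: contra jm => /eqP/injx -> //; rewrite inE.
  by rewrite (bigD1 i)//= subrr mul0r mul0r.
pose p := \sum_(m < M.+1) expR (c * x m) *: l m.
have px (i : 'I_M.+1) : p.[x i] = expR (c * x i).
  rewrite horner_sum (bigD1 i)//= hornerZ lx eqxx mulr1 big1 ?addr0// => m mi.
  by rewrite hornerZ lx eq_sym (negbTE mi) mulr0.
have pE t : \sum_(m < M.+1)
      (\prod_(j < M.+1 | j != m :> nat) ((t - x j) / (x m - x j))) *
        expR (c * x m) = p.[t].
  by rewrite horner_sum; apply: eq_bigr => m _; rewrite hornerZ lE mulrC.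
rewrite pE.
have [[i si]|snode] := pselect (exists i : 'I_M.+1, s = x i).
  exists a; first by rewrite lexx; case/andP: sab => /le_trans; apply.
  by rewrite si px subrr (bigD1 i)//= subrr mul0r mulr0.
pose W : {poly R} := \prod_(j < M.+1) ('X - (x j)%:P).
have Wx (i : 'I_M.+1) : W.[x i] = 0.
  by rewrite horner_prod (bigD1 i)//= hornerXsubC subrr mul0r.
have WE t : W.[t] = \prod_(j < M.+1) (t - x j).
  by rewrite horner_prod; apply: eq_bigr => j _; rewrite hornerXsubC.
have Ws0 : W.[s] != 0.
  rewrite WE; apply/prodf_neq0 => j _; rewrite subr_eq0.
  by apply/negP => /eqP sj; apply: snode; exists j.
have szW : size W = M.+2 by rewrite size_prod_XsubC /index_enum -enumT size_enum_ord.
have szp : (size p <= M.+1)%N.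
  apply: (leq_trans (size_sum _ _ _)); apply/bigmax_leqP => m _.
  apply: (leq_trans (size_scale_leq _ _)).
  rewrite /l scaler_prod; apply: (leq_trans (size_scale_leq _ _)).
  rewrite -big_filter size_prod_XsubC ltnS size_filter -sum1_count.
  rewrite (eq_bigl (fun j => j \in predC1 m)); last by move=> j; rewrite !inE.
  by rewrite sum1_card cardC1 card_ord.
(* chosen so that p + kap W agrees with the exponential at s too *)
pose kap := (expR (c * s) - p.[s]) / W.[s].
pose q := p + kap *: W.
pose r := sort <=%R (s :: [seq x i | i <- iota 0 M.+1]).
have szr : size r = M.+2 by rewrite size_sort /= size_map size_iota.
have rz : {in r, forall t, 1 * expR (c * t) - q.[t] = 0 /\ a <= t <= b}.
  move=> t; rewrite mem_sort inE mul1r hornerD hornerZ => /predU1P[->|].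
    by rewrite /kap divfK// subrKC subrr.
  case/mapP => i; rewrite mem_iota /= add0n => iM ->.
  by rewrite (px (Ordinal iM)) (Wx (Ordinal iM)) mulr0 addr0 subrr; split => //; exact: xab.
have : sorted <%R r.
  rewrite sort_lt_sorted cons_uniq map_inj_in_uniq ?iota_uniq ?andbT.
    apply/mapP => -[i]; rewrite mem_iota /= add0n => iM si.
    by apply: snode; exists (Ordinal iM).
  by move=> i j; rewrite !mem_iota /= !add0n => iM jM; exact: injx.
case: r szr rz => // y r [szr] rz yr.
have [t tab] := exp_sub_poly_zeros yr rz.
rewrite szr derivn_size; last first.
  rewrite (leq_trans (size_polyD _ _))// geq_max (leq_trans szp)//=.
  by rewrite (leq_trans (size_scale_leq _ _)) ?szW.
have -> : q`_M.+1 = kap.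
  rewrite coefD coefZ nth_default ?add0r//.
  have /monicP : W \is monic by apply: monic_prod_XsubC.
  by rewrite lead_coefE szW /= => ->; rewrite mulr1.
rewrite hornerC mul1r => Et.
exists t => //; rewrite -WE -[LHS](divfK Ws0) -/kap; congr (_ * _).
by rewrite mulrAC Et -(mulr_natr kap) mulfK// pnatr_eq0 -lt0n fact_gt0.
Qed.

(** * Chebyshev nodes *)

(** [sin_poly k] is the Chebyshev polynomial U_(k-1) of the second kind,
    shifted in index so that it is the polynomial in cos t equal to sin (kt) /
    sin t and has size k. *)
Fixpoint sin_poly (R : nzRingType) (k : nat) : {poly R} :=
  match k with
  | 0 => 0
  | 1 => 1
  | (k''.+1 as k').+1 => 'X * sin_poly R k' *+ 2 - sin_poly R k''
  end.

Lemma size_sin_poly (R : nzRingType) (k : nat) : (size (sin_poly R k) <= k)%N.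
Proof.
suff [] : (size (sin_poly R k) <= k)%N /\ (size (sin_poly R k.+1) <= k.+1)%N by [].
elim: k => [|k [IH1 IH2]]; first by rewrite size_poly0 size_poly1.
split => //; rewrite (leq_trans (size_polyD _ _))// size_polyN geq_max.
rewrite (leq_trans IH1) ?andbT; last by rewrite -addn2 leq_addr.
rewrite mulr2n (leq_trans (size_polyD _ _))// maxnn.
by rewrite (leq_trans (size_polyMleq _ _))// size_polyX.
Qed.

Lemma coef_sin_poly (R : nzRingType) (k : nat) : (sin_poly R k.+1)`_k = 2 ^+ k.
Proof.
elim: k => [|k IHk]; first by rewrite coefC expr0.
change (sin_poly R k.+2) with ('X * sin_poly R k.+1 *+ 2 - sin_poly R k).
rewrite coefB coefMn coefXM /= IHk [X in _ - X]nth_default ?subr0; last first.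
  by rewrite (leq_trans (size_sin_poly _ _)).
by rewrite exprSr mulr_natr.
Qed.

Lemma sin_polyE (R : realType) (k : nat) (t : R) :
  (sin_poly R k).[cos t] * sin t = sin (k%:R * t).
Proof.
suff [] : (sin_poly R k).[cos t] * sin t = sin (k%:R * t) /\
  (sin_poly R k.+1).[cos t] * sin t = sin (k.+1%:R * t) by [].
elim: k => [|k [IH1 IH2]]; first by rewrite horner0 hornerC !mul0r !mul1r sin0.
split => //.
change (sin_poly R k.+2) with ('X * sin_poly R k.+1 *+ 2 - sin_poly R k).
rewrite hornerD hornerN hornerMn hornerM hornerX mulrBl IH1.
have -> : k.+2%:R * t = k.+1%:R * t + t by rewrite -[k.+2]addn1 natrD mulrDl mul1r.
have -> : k%:R * t = k.+1%:R * t - t by rewrite -[k.+1]addn1 natrD mulrDl mul1r addrK.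
rewrite sinB sinD -IH2 mulr2n; ring.
Qed.

Lemma sin_natMpi (R : realType) (k : nat) : sin (k%:R * pi) = 0 :> R.
Proof.
elim: k => [|k IHk]; first by rewrite mul0r sin0.
by rewrite -natr1 mulrDl mul1r sinDpi IHk oppr0.
Qed.

Lemma cheb_angle_itv (R : realType) (M m : nat) :
  (m <= M)%N -> m%:R * pi / M%:R \in `[0, pi :> R].
Proof.
move=> mM; rewrite in_itv /=; case: M mM => [|M] mM.
  by rewrite invr0 mulr0 lexx pi_ge0.
rewrite divr_ge0 ?mulr_ge0 ?pi_ge0//=.
by rewrite ler_pdivrMr ?ltr0n// mulrC ler_wpM2l ?pi_ge0// ler_nat.
Qed.

Lemma cheb_angle_inj (R : realType) (M : nat) :
  {in gtn M.+1 &, injective (fun m : nat => cos (m%:R * pi / M%:R) : R)}.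
Proof.
move=> i j; rewrite !inE !ltnS => iM jM /cos_inj.
move=> /(_ (cheb_angle_itv R iM) (cheb_angle_itv R jM)).
case: M iM jM => [|M] iM jM; first by move: iM jM; rewrite !leqn0 => /eqP-> /eqP->.
move/(mulIf (_ : M.+1%:R^-1 != 0)); rewrite invr_eq0 pnatr_eq0 => /(_ isT).
move/(mulIf (_ : pi != 0 :> R)); rewrite gt_eqF ?pi_gt0// => /(_ isT)/eqP.
by rewrite eqr_nat => /eqP.
Qed.

(** The points cos (j pi / M), 0 <= j <= M, are the zeros of sin t sin (Mt),
    which is -(X^2 - 1) U_(M-1) at X = cos t; comparing degrees and leading
    coefficients gives the factorisation. *)
Lemma cheb_prod (R : realType) (M : nat) :
  ('X^2 - 1) * sin_poly R M.+1 = 2 ^+ M *: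
    \prod_(j < M.+2) ('X - (cos (j%:R * pi / M.+1%:R) : R)%:P).
Proof.
pose rs := [seq (cos (m%:R * pi / M.+1%:R) : R) | m <- iota 0 M.+2].
have szV : size (sin_poly R M.+1) = M.+1.
  apply/eqP; rewrite eqn_leq size_sin_poly/= ltnNge; apply/negP => szV.
  have := coef_sin_poly R M; rewrite nth_default// => /esym/eqP.
  by rewrite expf_eq0 pnatr_eq0 andbF.
have szX : size ('X^2 - 1 : {poly R}) = 3 by rewrite size_XnsubC.
have V0 : sin_poly R M.+1 != 0 by rewrite -size_poly_eq0 szV.
have X0 : 'X^2 - 1 != 0 :> {poly R} by rewrite -size_poly_eq0 szX.
have := @all_roots_prod_XsubC R (('X^2 - 1) * sin_poly R M.+1) rs.
rewrite size_mul// szX szV size_map size_iota => /(_ erefl).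
rewrite uniq_rootsE.
have -> : uniq rs.
  rewrite map_inj_in_uniq ?iota_uniq// => i j.
  by rewrite !mem_iota /= !add0n => iM jM; apply: cheb_angle_inj.
have -> : all (root (('X^2 - 1) * sin_poly R M.+1)) rs.
  apply/allP => _ /mapP[m _ ->]; rewrite rootM !rootE !hornerE.
  have [s0|s0] := eqVneq (sin (m%:R * pi / M.+1%:R) : R) 0.
    by rewrite cos2sin2 s0 expr0n /= subr0 subrr eqxx.
  apply/orP; right; rewrite -(mulIr_eq0 _ (mulIf s0)) sin_polyE.
  by rewrite mulrCA divff ?pnatr_eq0// mulr1 sin_natMpi.
move=> /(_ isT isT) ->.
rewrite lead_coefM lead_coefXnsubC// mul1r lead_coefE szV coef_sin_poly.
congr (_ *: _); rewrite big_map -[iota _ _]/(index_iota 0 M.+2).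
by rewrite big_mkord.
Qed.

(** At x = cos t the product is - sin t sin (Mt) / 2^(M-1), hence the bound.
    The case M = 0 has the single node cos 0 = 1 and is checked directly. *)
Lemma cheb_prod_le (R : realType) (M : nat) (x : R) : -1 <= x <= 1 ->
  `|\prod_(j < M.+1) (x - cos (j%:R * pi / M%:R))| <= 2 / 2 ^+ M.
Proof.
move=> x1; case: M => [|M].
  rewrite big_ord1 mul0r mul0r cos0 expr0 divr1 ler_norml.
  by move: x1 => /andP[]; lra.
have -> : \prod_(j < M.+2) (x - cos (j%:R * pi / M.+1%:R)) =
    - (sin (acos x) * sin (M.+1%:R * acos x)) / 2 ^+ M.
  apply: (@mulfI _ (2 ^+ M)); first by rewrite expf_eq0 pnatr_eq0 andbF.
  rewrite mulrCA divff ?mulr1; last by rewrite expf_eq0 pnatr_eq0 andbF.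
  transitivity (('X^2 - 1) * sin_poly R M.+1).[x].
    rewrite cheb_prod hornerZ horner_prod.
    by congr (_ * _); apply: eq_bigr => j _; rewrite hornerXsubC.
  rewrite -sin_polyE acosK ?in_itv//= !hornerE.
  have := cos2Dsin2 (acos x); rewrite acosK ?in_itv//= => E.
  have -> : x ^+ 2 - 1 = - sin (acos x) ^+ 2 by rewrite -E; ring.
  ring.
rewrite normrM normrN normfV (ger0_norm (exprn_ge0 _ _))// exprS invfM mulrA divff// mul1r.
rewrite ler_pdivrMr ?exprn_gt0// mulVf ?expf_eq0 ?pnatr_eq0 ?andbF// normrM.
by rewrite mulr_ile1 ?normr_ge0 ?sin_max.
Qed.

Lemma cheb_node_inj (R : realType) (a b : R) (M : nat) : a < b ->
  {in gtn M.+1 &, injective (cheb_node a b M)}.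
Proof.
move=> ab i j iM jM /addrI/mulfI E; apply: (cheb_angle_inj iM jM).
by apply: E; rewrite mulf_eq0 invr_eq0 pnatr_eq0 orbF subr_eq0 gt_eqF.
Qed.

Lemma cheb_node_itv (R : realType) (a b : R) (M m : nat) : a <= b ->
  a <= cheb_node a b M m <= b.
Proof.
move=> ab; rewrite /cheb_node; set y := cos _.
have := cos_max (m%:R * pi / M%:R : R); rewrite -/y ler_norml => /andP[y1 y2].
by apply/andP; split; nra.
Qed.

(** The Chebyshev bound after the affine change of variable. It yields the
    factor (b - a) / 4 per node, where arbitrary nodes would only give b - a.
    *)
Lemma cheb_node_prod_le (R : realType) (a b s : R) (M : nat) :
  a < b -> a <= s <= b ->
  `|\prod_(j < M.+1) (s - cheb_node a b M j)| <= 4 * ((b - a) / 4) ^+ M.+1.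
Proof.
move=> ab /andP[as_ sb].
pose x := (s - (a + b) / 2) / ((b - a) / 2).
have h0 : 0 < (b - a) / 2 by lra.
have x1 : -1 <= x <= 1.
  by rewrite /x ler_pdivrMr// ler_pdivlMr//; apply/andP; split; lra.
have -> : \prod_(j < M.+1) (s - cheb_node a b M j) =
    ((b - a) / 2) ^+ M.+1 * \prod_(j < M.+1) (x - cos (j%:R * pi / M%:R)).
  rewrite -[X in _ ^+ X](card_ord M.+1) -prodr_const -big_split /=; apply: eq_bigr => j _.
  by rewrite mulrBr /x mulrC divfK ?gt_eqF// /cheb_node opprD addrA.
rewrite normrM ger0_norm ?exprn_ge0 ?(ltW h0)//.
apply: le_trans (ler_wpM2l (exprn_ge0 _ (ltW h0)) (cheb_prod_le M x1)) _.
have -> : (b - a) / 4 = (b - a) / 2 / 2 by field.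
rewrite [X in _ <= _ * X]expr_div_n [2 ^+ M.+1]exprS le_eqVlt; apply/orP; left; apply/eqP.
by field; rewrite expf_eq0 pnatr_eq0 andbF.
Qed.

(** * Interpolation error of the kernel *)

(** The inductive step is (1 + 1/(n+1))^(n+1) <= e. *)
Lemma natX_self_le_fact (R : realType) (n : nat) :
  n.+1%:R ^+ n.+1 <= (n.+1)`!%:R * expR n%:R :> R.
Proof.
elim: n => [|n IHn]; first by rewrite expR0 mulr1.
have n1 : 0 < n.+1%:R :> R by rewrite ltr0n.
have E : n.+2%:R = n.+1%:R * (1 + n.+1%:R^-1) :> R.
  by rewrite mulrDr mulr1 divff ?gt_eqF// natr1.
rewrite exprS {2}E exprMn factS natrM -!mulrA ler_pM2l ?ltr0n//.
have -> : expR n.+1%:R = expR n%:R * expR 1 :> R by rewrite -expRD natr1.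
rewrite [X in _ <= X]mulrA; apply: ler_pM => //.
apply: (@le_trans _ _ (expR n.+1%:R^-1 ^+ n.+1)).
    by rewrite lerXn2r ?nnegrE ?expR_ge0 ?expR_ge1Dx// addr_ge0// invr_ge0 ltW.
  by rewrite -expRM_natr mulVf ?gt_eqF.
Qed.

(** A term of index at least 1 of the exponential series is at most e^(y-1),
    not just e^y: the logarithm of e^y n! / y^n is least at y = n, where
    [natX_self_le_fact] applies. This gain is the factor e^-1 in the summand 4
    e^-1 of C_k. *)
Lemma exp_term_le (R : realType) (n : nat) (y : R) : 0 <= y ->
  y ^+ n.+1 / (n.+1)`!%:R <= expR (y - 1).
Proof.
move=> y0; have n1 : 0 < n.+1%:R :> R by rewrite ltr0n.
rewrite ler_pdivrMr ?ltr0n ?fact_gt0//.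
have H : (y / n.+1%:R) ^+ n.+1 <= expR (y - n.+1%:R).
  have -> : y - n.+1%:R = (y / n.+1%:R - 1) * n.+1%:R.
    by rewrite mulrBl mul1r divfK ?gt_eqF.
  rewrite expRM_natr lerXn2r ?nnegrE ?expR_ge0 ?divr_ge0 ?(ltW n1)//.
  by apply: le_trans (expR_ge1Dx _); rewrite subrKC.
have -> : y - 1 = (y - n.+1%:R) + n%:R by rewrite -natr1; ring.
rewrite expRD -mulrA [expR n%:R * _]mulrC.
apply: (le_trans _ (ler_pM _ _ H (natX_self_le_fact R n))).
- by rewrite -exprMn divfK// gt_eqF.
- by rewrite exprn_ge0// divr_ge0 ?(ltW n1).
- by rewrite exprn_ge0// ltW.
Qed.

(** The interpolation error of s |-> r^(-2s), relative to r^-(a+g+s). With L =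
    |ln r| and N = M + 1, the remainder formula and the Chebyshev bound give 4
    ((b - a) / 2)^N L^N / N! r^(-2t). Bounding b - a by (1/2 - xi) g and
    writing (1/2 - xi) g / 2 = rho (2 xi g), with rho = (1/xi - 2) / 8, turns
    this into 4 rho^N (2 xi g L)^N / N! r^(-2t), and [exp_term_le] replaces
    the power of the logarithm by e^-1 r^(-2 xi g) if r <= 1, or e^-1 r^(2 xi
    g) if r > 1. For r <= 1 this is absorbed by r^-(a+g+s), because 2t + 2 xi
    g <= a + g + s; for r > 1 what remains is at most r^(g+1). *)
Lemma interp_kernel_error (R : realType) (a b g xi s r C : R) (M : nat) :
  0 < xi < 1 / 2 -> 0 < g <= 1 / 2 -> a < b -> b - a <= (1 / 2 - xi) * g ->
  a <= s <= b -> 0 < r ->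
  4 * expR (- 1) <= C -> (1 < r -> 4 * r `^ (g + 1) <= C) ->
  `|expR (- 2 * ln r * s) - \sum_(m < M.+1)
     lagrange_val a b M m s * expR (- 2 * ln r * cheb_node a b M m)| <=
  C * (1 / 8 * (xi^-1 - 2)) ^+ M.+1 * expR (- ((a + g + s) * ln r)).
Proof.
move=> /andP[xi0 xi1] /andP[g0 g1] ab bag sab r0 C1 C2.
have [t /andP[at_ tb] ->] :=
  lagrange_exp_remainder (- 2 * ln r) (cheb_node_inj (M := M) ab)
  (fun i _ => cheb_node_itv M i (ltW ab)) sab.
have [as_ sb] := andP sab.
set L := ln r; set rho := 1 / 8 * _.
have rho0 : 0 <= rho.
  rewrite mulr_ge0 ?divr_ge0// subr_ge0 -[2]invrK lef_pV2 ?posrE//; lra.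
(* the rate rho makes the bound on b - a a multiple of 2 xi g *)
have rhoE : rho * (2 * xi * g) = (1 / 2 - xi) * g / 2.
  by rewrite /rho; field; rewrite gt_eqF.
have h : 2 * ((b - a) / 4) <= rho * (2 * xi * g) by rewrite rhoE; lra.
have y0 : 0 <= 2 * xi * g * `|L| by rewrite !mulr_ge0// ltW.
rewrite normrM.
apply: (@le_trans _ _
    (4 * rho ^+ M.+1 * expR (2 * xi * g * `|L| - 1) * expR (- 2 * L * t))).
  apply: le_trans (ler_wpM2l (normr_ge0 _) (cheb_node_prod_le M ab sab)) _.
  rewrite normrM (gtr0_norm (expR_gt0 _)) normrM normfV normr_nat normrX.
  rewrite normrM normrN normr_nat.
  set e := expR (-2 * L * t).
  have -> : (2 * `|L|) ^+ M.+1 / (M.+1)`!%:R * e * (4 * ((b - a) / 4) ^+ M.+1) =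
     4 * ((2 * ((b - a) / 4) * `|L|) ^+ M.+1 / (M.+1)`!%:R) * e.
    rewrite !exprMn; ring.
  rewrite ler_wpM2r ?expR_ge0// -[X in _ <= X]mulrA ler_wpM2l//.
  apply: (le_trans _ (ler_wpM2l (exprn_ge0 _ rho0) (exp_term_le M y0))).
  rewrite [X in _ <= X]mulrA -exprMn ler_wpM2r ?invr_ge0//.
  rewrite lerXn2r ?nnegrE ?(mulr_ge0 rho0 y0)//.
    by rewrite mulr_ge0// mulr_ge0// divr_ge0// subr_ge0 ltW.
  by rewrite [X in _ <= X]mulrA ler_wpM2r.
have [r1|r1] := leP r 1.
  have L0 : L <= 0 by exact: ln_le0.
  apply: (@le_trans _ _
    (4 * expR (- 1) * rho ^+ M.+1 * expR (- ((a + g + s) * L)))).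
    have -> : 4 * expR (-1) * rho ^+ M.+1 * expR (- ((a + g + s) * L)) =
        4 * rho ^+ M.+1 * (expR (- 1) * expR (- ((a + g + s) * L))) by ring.
    rewrite -mulrA -!expRD ler_wpM2l ?mulr_ge0 ?exprn_ge0// ler_expR ler0_norm//.
    nra.
  by rewrite ler_wpM2r ?expR_ge0// ler_wpM2r ?exprn_ge0.
have L0 : 0 <= L by rewrite ln_ge0// ltW.
apply: (@le_trans _ _
    (4 * r `^ (g + 1) * rho ^+ M.+1 * expR (- ((a + g + s) * L)))).
  have -> : 4 * r `^ (g + 1) * rho ^+ M.+1 * expR (- ((a + g + s) * L)) =
      4 * rho ^+ M.+1 * (r `^ (g + 1) * expR (- ((a + g + s) * L))) by ring.
  rewrite /powR gt_eqF// -mulrA -!expRD ler_wpM2l ?mulr_ge0 ?exprn_ge0//.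
  rewrite ler_expR -/L ger0_norm//.
  (* s - t <= b - a <= (1/2 - xi) g and g <= 1/2 *)
  have : (2 * xi * g - 2 * t) <= 1 - a - s by nra.
  nra.
by rewrite ler_wpM2r ?expR_ge0// ler_wpM2r ?exprn_ge0// C2.
Qed.

Lemma expRN1_ge (R : realType) : 1 / 4 <= expR (- 1) :> R.
Proof.
have -> : - 1 = - (1 / 2) + - (1 / 2) :> R by field.
rewrite expRD; have := expR_ge1Dx (- (1 / 2) : R); nra.
Qed.

(** The analogue of [interp_kernel_error] without any node, for the orders
    below 0, where the interpolated form is 0. *)
Lemma kernel_le_no_node (R : realType) (a g s r C : R) :
  a <= s <= a + g -> 0 < r ->
  4 * expR (- 1) <= C -> (1 < r -> 4 * r `^ (g + 1) <= C) ->
  expR (- 2 * ln r * s) <= C * expR (- ((a + g + s) * ln r)).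
Proof.
move=> /andP[as_ sag] r0 C1 C2; set L := ln r.
have [r1|r1] := leP r 1.
  have L0 : L <= 0 by exact: ln_le0.
  apply: (@le_trans _ _ (1 * expR (- ((a + g + s) * L)))).
    by rewrite mul1r ler_expR; nra.
  rewrite ler_wpM2r ?expR_ge0// (le_trans _ C1)//.
  by have := expRN1_ge R; lra.
have L0 : 0 <= L by rewrite ln_ge0// ltW.
apply: (@le_trans _ _ (r `^ (g + 1) * expR (- ((a + g + s) * L)))).
  by rewrite /powR gt_eqF// -expRD ler_expR -/L; nra.
rewrite ler_wpM2r ?expR_ge0// (le_trans _ (C2 r1))//.
by rewrite ler_peMl ?powR_ge0 ?ler1n.
Qed.

(** * From kernel estimates to nonlocal forms *)

Lemma Rintegral_sum d (T : measurableType d) (R : realType)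
    (mu : {measure set T -> \bar R}) (D : set T) (I : Type) (r : seq I)
    (F : I -> T -> R) :
  measurable D -> (forall i, mu.-integrable D (EFin \o F i)) ->
  \int[mu]_(x in D) (\sum_(i <- r) F i x) =
  \sum_(i <- r) \int[mu]_(x in D) F i x.
Proof.
move=> mD iF; elim: r => [|i r IHr].
  rewrite big_nil -[RHS](Rintegral_set0 mu (cst 0)) Rintegral_mkcond [RHS]Rintegral_mkcond.
  congr Rintegral; apply/funext => x; rewrite !patchE in_set0.
  by case: ifP => // _; rewrite big_nil.
rewrite big_cons -IHr -RintegralD//.
  by apply: eq_Rintegral => x _; rewrite big_cons.
have -> : EFin \o (fun x => \sum_(j <- r) F j x) =
    fun x => (\sum_(j <- r) (F j x)%:E)%E.
  by apply/funext => x /=; rewrite sumEFin.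
by apply: integrable_sum => // j _; exact: iF.
Qed.

(** Cauchy-Schwarz for a function dominated on [D] by a product. It also
    provides the integrability that splitting the interpolated form into its
    terms requires. *)
Lemma Rintegral_le_Lnorm2 d (T : measurableType d) (R : realType)
    (mu : {measure set T -> \bar R}) (D : set T) (f h F : T -> R) (c : R) :
  measurable D -> measurable_fun setT f -> measurable_fun setT h ->
  measurable_fun D F -> 0 <= c ->
  (forall x, D x -> `|F x| <= c * `|f x * h x|) ->
  ('N[mu]_2%:E[EFin \o f] * 'N[mu]_2%:E[EFin \o h] < +oo)%E ->
  mu.-integrable D (EFin \o F) /\
  ((`|\int[mu]_(x in D) F x|)%:E <=
    c%:E * ('N[mu]_2%:E[EFin \o f] * 'N[mu]_2%:E[EFin \o h]))%E.
Proof.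
move=> mD mf mh mF c0 FE fin.
have H : (\int[mu]_x `|(f x * h x)%:E| <=
    'N[mu]_2%:E[EFin \o f] * 'N[mu]_2%:E[EFin \o h])%E.
  rewrite -(Lnorm1 mu (EFin \o (f \* h))).
  by apply: hoelder => //; field.
have mfh : measurable_fun setT (f \* h) by exact: measurable_funM.
have ifh : mu.-integrable setT (EFin \o (f \* h)).
  apply/integrableP; split; first exact/measurable_EFinP.
  exact: le_lt_trans H fin.
have iF : mu.-integrable D (EFin \o F).
  apply: (@le_integrable _ _ _ _ _ mD _ (EFin \o (fun x => c * (f x * h x)))).
  - exact/measurable_EFinP.
  - by move=> x Dx; rewrite /= lee_fin normrM (ger0_norm c0) FE.
  - by apply: (@integrableZl _ _ _ _ _ mD c (EFin \o (f \* h))); apply: integrableS ifh.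
split => //.
have mEF : measurable_fun D (EFin \o F) by exact/measurable_EFinP.
rewrite EFin_normr_Rintegral//.
apply: (le_trans (le_abse_integral mu mD mEF)).
apply: (@le_trans _ _ (\int[mu]_(x in D) (c%:E * `|(f x * h x)%:E|))%E).
  apply: ge0_le_integral => //.
  - exact: measurableT_comp.
  - apply/measurable_EFinP; apply: measurable_funM => //.
    by apply: measurableT_comp => //; exact: measurable_funTS.
rewrite ge0_integralZl//; first last.
  by apply/measurable_EFinP; apply: measurableT_comp => //; exact: measurable_funTS.
apply: lee_wpmul2l; first by rewrite lee_fin.
apply: le_trans H; apply: ge0_subset_integral => //.
by apply/measurable_EFinP; apply: measurableT_comp.
Qed.

Section nonlocal.
Context (R : realType) (n : nat).
Implicit Types (u v : 'rV[R]_n -> R) (z : 'rV[R]_n * 'rV[R]_n).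

Lemma enorm_ge0 (x : 'rV[R]_n) : 0 <= enorm x.
Proof. exact: sqrtr_ge0. Qed.

Lemma enorm_eq0 (x : 'rV[R]_n) : enorm x = 0 -> x = 0.
Proof.
move=> /eqP; rewrite sqrtr_eq0 => x0; apply/rowP => i.
have : \sum_i x ord0 i ^+ 2 == 0.
  by rewrite eq_le x0 sumr_ge0// => j _; exact: sqr_ge0.
rewrite psumr_eq0 => [/allP/(_ i (mem_index_enum i))|j _]; last exact: sqr_ge0.
by rewrite sqrf_eq0 mxE => /eqP.
Qed.

Lemma measurable_dist :
  measurable_fun setT (fun z : 'rV[R]_n * 'rV[R]_n => enorm (z.1 - z.2)).
Proof.
have -> : (fun z : 'rV[R]_n * 'rV[R]_n => enorm (z.1 - z.2)) =
    fun z => (\sum_i (rV_coord i z.1 - rV_coord i z.2) ^+ 2) `^ 2^-1.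
  apply/funext => z; rewrite powR12_sqrt; last first.
    by apply: sumr_ge0 => i _; exact: sqr_ge0.
  by congr Num.sqrt; apply: eq_bigr => i _; rewrite !mxE.
apply: (measurableT_comp (measurable_powR _)).
apply: measurable_sum => i; apply: measurable_funX; apply: measurable_funB.
  by apply: measurableT_comp => //; exact: measurable_rV_coord.
by apply: measurableT_comp => //; exact: measurable_rV_coord.
Qed.

Lemma measurable_near_diagonal (delta : R) :
  measurable [set z : 'rV[R]_n * 'rV[R]_n | enorm (z.1 - z.2) <= delta].
Proof.
rewrite -[X in measurable X]setTI.
exact: (measurable_fun_ler measurable_dist (measurable_cst delta)) measurableT
  [set true] _.
Qed.

(** With p = (n + 2t) / 2 this is the function whose L^2 norm is the Gagliardo
    seminorm of order t; it vanishes on the diagonal. *)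
Definition diff_quotient (p : R) v z : R :=
  (v z.1 - v z.2) / enorm (z.1 - z.2) `^ p.

Lemma measurable_diff_quotient (p : R) v : measurable_fun setT v ->
  measurable_fun setT (diff_quotient p v).
Proof.
move=> mv; apply: measurable_funM.
  by apply: measurable_funB; apply: measurableT_comp.
have -> : (fun z : 'rV[R]_n * 'rV[R]_n => (enorm (z.1 - z.2) `^ p)^-1) =
    fun z => enorm (z.1 - z.2) `^ (- p).
  by apply/funext => z; rewrite powRN.
exact: (measurableT_comp (measurable_powR _) measurable_dist).
Qed.

Lemma gagliardo_Lnorm (t : R) v : gagliardo t v =
  'N[(leb R n \x leb R n)%E]_2%:E[EFin \o diff_quotient ((n%:R + 2 * t) / 2) v]%E.
Proof.
rewrite unlock /Lnorm /gagliardo; congr poweR; apply: eq_integral => z _.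
rewrite /= powR_mulrn// real_normK ?num_real//; congr (_%:E).
rewrite /diff_quotient expr_div_n -(powR_mulrn 2 (powR_ge0 _ _)) -powRrM divfK//.
Qed.

(** The kernel of order sg is the product of the difference quotients of
    orders t and s times |x-y|^(t+s-2sg): all the dependence on sg is in a
    scalar function of the distance. *)
Lemma kernel_diff_quotientE (t s sg : R) u v z : 0 < enorm (z.1 - z.2) ->
  (u z.1 - u z.2) * (v z.1 - v z.2) / enorm (z.1 - z.2) `^ (n%:R + 2 * sg) =
  diff_quotient ((n%:R + 2 * t) / 2) u z *
  diff_quotient ((n%:R + 2 * s) / 2) v z *
  (expR ((t + s) * ln (enorm (z.1 - z.2))) *
   expR (- 2 * ln (enorm (z.1 - z.2)) * sg)).
Proof.
move=> r0; rewrite /diff_quotient /powR !gt_eqF// -!expRN -!mulrA; congr (_ * _).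
rewrite mulrCA; congr (_ * _); rewrite -!expRD; congr expR; by field.
Qed.

Lemma kernel_diag (p : R) u v z : ~~ (0 < enorm (z.1 - z.2)) ->
  (u z.1 - u z.2) * (v z.1 - v z.2) / enorm (z.1 - z.2) `^ p = 0.
Proof.
rewrite lt_neqAle enorm_ge0 andbT negbK eq_sym => /eqP/enorm_eq0/eqP.
by rewrite subr_eq0 => /eqP ->; rewrite subrr !mul0r.
Qed.

(** Pointwise kernel estimates become estimates of the forms: if a combination
    of the powers r^(-2 sg_i) approximates r^(-2s) up to eta r^-(t+s) on ]0,
    delta], the same combination of the forms approximates the form of order s
    up to eta times the seminorms. The condition 2 sg_i <= t + s bounds the
    kernel of order sg_i by a multiple of the one of order (t + s) / 2 on the
    truncated domain, so that every form in the sum is a convergent integral.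
    *)
Lemma nonlocal_form_error (u v : 'rV[R]_n -> R) (t s delta eta : R) (N : nat)
    (w sg : 'I_N -> R) :
  measurable_fun setT u -> measurable_fun setT v ->
  0 < delta -> 0 <= eta -> s <= t -> (forall i, 2 * sg i <= t + s) ->
  (forall r, 0 < r <= delta ->
    `|expR (- 2 * ln r * s) - \sum_(i < N) w i * expR (- 2 * ln r * sg i)| <=
    eta * expR (- ((t + s) * ln r))) ->
  (gagliardo t u * gagliardo s v < +oo)%E ->
  (`|nonlocal_form u v s delta -
     \sum_(i < N) w i * nonlocal_form u v (sg i) delta|%:E
    <= eta%:E * (gagliardo t u * gagliardo s v))%E.
Proof.
move=> mu mv d0 eta0 st sgt err; rewrite !gagliardo_Lnorm => fin.
pose m : {measure set _ -> \bar R} := (leb R n \x leb R n)%E.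
rewrite -/m in fin *.
set D := [set z : 'rV[R]_n * 'rV[R]_n | enorm (z.1 - z.2) <= delta].
have mD : measurable D := measurable_near_diagonal delta.
pose F (sg : R) z :=
  (u z.1 - u z.2) * (v z.1 - v z.2) / enorm (z.1 - z.2) `^ (n%:R + 2 * sg).
have mF sg0 : measurable_fun D (F sg0).
  apply: measurable_funTS.
  have -> : F sg0 = fun z => diff_quotient (n%:R + 2 * sg0) u z * (v z.1 - v z.2).
    by apply/funext => z; rewrite /F /diff_quotient mulrAC.
  apply: measurable_funM; first exact: measurable_diff_quotient.
  by apply: measurable_funB; apply: measurableT_comp.
have mqu := measurable_diff_quotient ((n%:R + 2 * t) / 2) mu.
have mqv := measurable_diff_quotient ((n%:R + 2 * s) / 2) mv.
have iF sg0 : 2 * sg0 <= t + s -> m.-integrable D (EFin \o F sg0).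
  move=> sg0t.
  (* r^(t + s - 2 sg0) is increasing in r, hence largest at r = delta *)
  have [] // := @Rintegral_le_Lnorm2 _ _ R m D _ _ (F sg0)
    (expR ((t + s - 2 * sg0) * ln delta)) mD mqu mqv (mF sg0) (expR_ge0 _).
  move=> z Dz; have [r0|r0] := boolP (0 < enorm (z.1 - z.2)); last first.
    by rewrite /F kernel_diag// normr0 mulr_ge0// expR_ge0.
  rewrite /F (kernel_diff_quotientE t s)// normrM mulrC ler_wpM2r//.
  rewrite -expRD ger0_norm ?expR_ge0// ler_expR.
  have : ln (enorm (z.1 - z.2)) <= ln delta by rewrite ler_ln ?posrE.
  nra.
have is_ : m.-integrable D (EFin \o F s) by apply: iF; lra.
have iw i : m.-integrable D (EFin \o (fun z => w i * F (sg i) z)).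
  by apply: (@integrableZl _ _ _ _ _ mD (w i) (EFin \o F (sg i))); exact: iF.
have -> : nonlocal_form u v s delta -
    \sum_(i < N) w i * nonlocal_form u v (sg i) delta =
    \int[m]_(z in D) (F s z - \sum_(i < N) w i * F (sg i) z).
  rewrite RintegralB//; last first.
    have -> : EFin \o (fun z => \sum_(i < N) w i * F (sg i) z) =
        fun z => (\sum_(i < N) (w i * F (sg i) z)%:E)%E.
      by apply/funext => z /=; rewrite sumEFin.
    by apply: integrable_sum => // i _; exact: iw.
  rewrite Rintegral_sum//; congr (_ - _); apply: eq_bigr => i _.
  by rewrite RintegralZl//; exact: iF.
have [] // := @Rintegral_le_Lnorm2 _ _ R m D _ _
  (fun z => F s z - \sum_(i < N) w i * F (sg i) z) eta mD mqu mqv _ eta0.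
  apply: measurable_funB => //; apply: measurable_sum => i.
  exact: measurable_funM.
move=> z Dz; have [r0|r0] := boolP (0 < enorm (z.1 - z.2)); last first.
  rewrite /F kernel_diag// big1 ?subrr ?normr0 ?mulr_ge0// => i _.
  by rewrite kernel_diag// mulr0.
set q := diff_quotient _ u z * diff_quotient _ v z.
set L := ln (enorm (z.1 - z.2)).
have -> : F s z - \sum_(i < N) w i * F (sg i) z = q * expR ((t + s) * L) *
    (expR (- 2 * L * s) - \sum_(i < N) w i * expR (- 2 * L * sg i)).
  rewrite mulrBr mulr_sumr /F (kernel_diff_quotientE t s)// -/q -/L mulrA.
  congr (_ - _); apply: eq_bigr => i _.
  by rewrite (kernel_diff_quotientE t s)// -/q -/L; ring.
rewrite normrM normrM (ger0_norm (expR_ge0 _)).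
have /err : 0 < enorm (z.1 - z.2) <= delta by rewrite r0.
rewrite -/L => {}err.
apply: (le_trans (ler_wpM2l _ err)); first by rewrite mulr_ge0// expR_ge0.
rewrite expRN mulrACA [_ * eta]mulrC -mulrA divff ?mulr1//.
by rewrite gt_eqF ?expR_gt0.
Qed.

End nonlocal.

(** * Subintervals and interpolation orders *)

(** Rounding the logarithmic quotient up makes [k] steps of the geometric rate
    [rho] enough; stated for any [k] above the ceiling, as the order may be
    negative. *)
Lemma ceil_log_le (R : realType) (eta C rho : R) (k : nat) :
  0 < eta -> 0 < C -> 0 < rho < 1 ->
  Num.ceil (ln (eta / C) / ln rho) <= k%:Z -> C * rho ^+ k <= eta.
Proof.
move=> eta0 C0 /andP[rho0 rho1]; rewrite ceil_le_int => xk.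
have lrho : ln rho < 0 by rewrite ln_lt0// rho0.
rewrite mulrC -ler_pdivlMr//.
rewrite -(lnK (exprn_gt0 _ rho0)) -[X in _ <= X]lnK ?posrE ?divr_gt0//.
rewrite ler_expR lnXn// -mulr_natr mulrC -ler_ndivrMr//.
Qed.

Lemma cheb_rate_itv (R : realType) (xi : R) : 1 / 10 < xi < 1 / 2 ->
  0 < 1 / 8 * (xi^-1 - 2) < 1.
Proof.
move=> /andP[xi1 xi2]; have xi0 : 0 < xi by lra.
have x2 : 2 < xi^-1 by rewrite -[2]invrK ltf_pV2 ?posrE//; lra.
have x10 : xi^-1 < 10 by rewrite -[10]invrK ltf_pV2 ?posrE//; lra.
by apply/andP; split; lra.
Qed.

Section subintervals.
Context (R : realType) (smin smax xi eps eps0 : R).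
Hypotheses (xi_itv : 1 / 10 < xi < 1 / 2).
Hypotheses (smin_itv : 0 < smin < smax) (eps_itv : 0 < eps <= eps0).
Hypotheses (eps0_small : eps0 < Num.min (1 - smax) (1 / 2)).
Context (K : nat).
Hypothesis HK : last_index smin smax xi eps K.

(* a lower bound of all gaps, uniform in smin and eps *)
Let gam := Num.min (1 - smax) (1 / 2) - eps0.

Lemma s_minS k : (0 < k)%N ->
  s_min smin xi eps k.+1 = next_end xi eps (s_min smin xi eps k).
Proof. by case: k => // k _; rewrite /s_min /= . Qed.

Lemma s_min_lt k : (1 <= k <= K)%N -> s_min smin xi eps k < smax.
Proof.
case: k => // -[|k] /= kK; first by case/andP: smin_itv.
by rewrite s_minS//; have [_ _ ->] := HK.
Qed.

Lemma gap_ge t : t <= smax -> gam <= gap eps t.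
Proof.
move=> ts; rewrite /gam /gap lerB//; last by case/andP: eps_itv.
by rewrite le_min !ge_min lexx orbT andbT lerB.
Qed.

Lemma gap_le_half t : gap eps t <= 1 / 2.
Proof.
rewrite /gap lerBlDr ge_min; apply/orP; right.
by case/andP: eps_itv => e0 _; lra.
Qed.

Lemma gap_lb_gt0 : 0 < gam. Proof. by rewrite /gam subr_gt0. Qed.

Lemma g_itv k : (1 <= k <= K)%N -> 0 < g_ smin xi eps k <= 1 / 2.
Proof.
move=> kK; rewrite gap_le_half andbT (lt_le_trans gap_lb_gt0)// gap_ge// ltW//.
exact: s_min_lt.
Qed.

Lemma subinterval_lt k : (1 <= k <= K)%N ->
  s_min smin xi eps k < s_max smin smax xi eps K k.
Proof.
move=> kK; rewrite /s_max; case: ifP => _; last exact: s_min_lt.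
have /andP[g0 _] := g_itv kK.
rewrite /next_end ltrDl mulr_gt0//; by case/andP: xi_itv; lra.
Qed.

Lemma subinterval_length k : (1 <= k <= K)%N ->
  s_max smin smax xi eps K k - s_min smin xi eps k <=
  (1 / 2 - xi) * g_ smin xi eps k.
Proof.
move=> kK; rewrite lerBlDl -/(next_end xi eps _) /s_max; case: ltnP => // Kk.
have -> : k = K by apply/eqP; rewrite eqn_leq Kk; case/andP: kK => _ ->.
by case: HK.
Qed.

(** The order at which the regularity of u is measured is exactly at distance
    g_k from the left end of the subinterval, which is why g_k governs both
    the length of the subinterval and the decay of the kernel error. *)
Lemma s2barE k : s2bar smin xi eps k = s_min smin xi eps k + g_ smin xi eps k.
Proof.
by rewrite /s2bar /g_ /gap addrA addr_minr subrKC.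
Qed.

(** As all left ends stay below smax < 1, the steps have a length bounded
    below in terms of xi, smax and eps0 only, and they fit in an interval of
    length 1. *)
Lemma number_subintervals : K%:R <= 1 + ((1 / 2 - xi) * gam)^-1.
Proof.
set d := (1 / 2 - xi) * gam.
have xih : 0 < 1 / 2 - xi by case/andP: xi_itv; lra.
have d0 : 0 < d by rewrite mulr_gt0// gap_lb_gt0.
have lb k : (k < K)%N -> smin + k%:R * d <= s_min smin xi eps k.+1.
  elim: k => [|k IHk] kK; first by rewrite mul0r addr0.
  rewrite s_minS// /next_end -natr1 mulrDl mul1r addrA.
  rewrite lerD ?IHk 1?ltnW// /d ler_pM2l// gap_ge// ltW// s_min_lt//.
  exact: ltnW.
have [K1 _ _] := HK; case: K K1 lb s_min_lt => // K' _ lb lt.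
rewrite -natr1 addrC lerD2l -[X in _ <= X]mul1r ler_pdivlMr//.
have := lb K' (ltnSn _); have := lt K'.+1; rewrite leqnn => /(_ isT).
have := gap_lb_gt0; rewrite /gam subr_gt0 lt_min => /andP[].
case/andP: smin_itv; case/andP: eps_itv; lra.
Qed.

Lemma C_growth_ge1 delta k : 1 <= C_ smin xi eps delta k.
Proof.
have e4 := expRN1_ge R.
rewrite /C_; case: ifP => _; last lra.
have := powR_ge0 delta (g_ smin xi eps k + 1); lra.
Qed.

Lemma C_growth_le delta k :
  C_ smin xi eps delta k <= 4 * (expR (- 1) + delta ^+ 2).
Proof.
rewrite /C_; case: ifP => [d1|_]; last by rewrite ler_wpM2l// lerDl sqr_ge0.
rewrite ler_wpM2l// lerD2l -powR_mulrn; last lra.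
rewrite ler_powR ?(ltW d1)//; have := gap_le_half (s_min smin xi eps k).
rewrite -/(g_ smin xi eps k); lra.
Qed.

(** Since ln C_k lies between 0 and a bound depending on delta only, the order
    is at most an affine function of |ln eta|; for |ln eta| >= lambda > 0 its
    constant terms are absorbed in the factor. *)
Lemma interp_order_le delta eta lambda k :
  0 < eta -> 0 < lambda -> lambda <= `|ln eta| ->
  (interp_order smin xi eps delta eta k + 1)%:~R <=
  ((1 + ln (4 * (expR (- 1) + delta ^+ 2)) / lambda) /
     - ln (1 / 8 * (xi^-1 - 2)) + lambda^-1) * `|ln eta|.
Proof.
move=> eta0 la0 lae.
have /andP[r0 r1] := cheb_rate_itv xi_itv.
set rho := 1 / 8 * _ in r0 r1 *.
set Cm := 4 * _; set Ck := C_ smin xi eps delta k.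
have Ck1 : 1 <= Ck := C_growth_ge1 delta k.
have Ck0 : 0 < Ck by lra.
have lC : 0 <= ln Ck <= ln Cm.
  by rewrite ln_ge0// ler_ln ?posrE ?C_growth_le// (lt_le_trans Ck0 (C_growth_le _ _)).
have l0 : 0 < - ln rho by rewrite oppr_gt0 ln_lt0// r0.
rewrite /interp_order subrK -/Ck -/rho.
have /andP[+ _] := ceil_itv (ln (eta / Ck) / ln rho).
rewrite intrB ltrBlDr => /ltW/le_trans; apply.
rewrite mulrDl; apply: lerD; last by rewrite mulrC ler_pdivlMr// mul1r.
rewrite -[ln rho in X in X <= _]opprK invrN mulrN -mulNr mulrAC.
rewrite ler_pM2r ?invr_gt0// lnM ?posrE ?invr_gt0// lnV ?posrE//.
rewrite mulrDl mul1r opprB addrC lerD//; first by rewrite -normrN ler_norm.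
case/andP: lC => lC0 lC1; apply: (le_trans lC1).
by rewrite mulrAC ler_pdivlMr// ler_wpM2l// (le_trans lC0).
Qed.

End subintervals.

(** * Error and cost of the interpolated form *)

Lemma sobolev_measurable (R : realType) (n : nat) (t : R) (v : 'rV[R]_n -> R) :
  sobolev t v -> measurable_fun setT v.
Proof.
rewrite /sobolev; case: (Num.truncn t) => [|m] [vL _];
  exact: set_mem (sub_Lfun_mfun vL).
Qed.

(** The estimate on one subinterval [a, b] with gap g. If the product of
    seminorms is infinite there is nothing to prove; the order M is chosen so
    that C rho^(M+1) <= eta, and a negative M means that C <= eta. *)
Lemma interp_form_error (R : realType) (n : nat) (u v : 'rV[R]_n -> R)
    (a b g xi s delta eta C : R) (M : int) :
  measurable_fun setT u -> measurable_fun setT v ->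
  1 / 10 < xi < 1 / 2 -> 0 < g <= 1 / 2 -> a < b -> b - a <= (1 / 2 - xi) * g ->
  a <= s <= b -> 0 < delta -> 0 < eta ->
  C = (if 1 < delta then 4 * (expR (- 1) + delta `^ (g + 1))
       else 4 * expR (- 1)) ->
  M = Num.ceil (ln (eta / C) / ln (1 / 8 * (xi^-1 - 2))) - 1 ->
  (`|nonlocal_form u v s delta - interp_form a b M u v s delta|%:E <=
    eta%:E * gagliardo (a + g) u * gagliardo s v)%E.
Proof.
move=> mu mv xi_itv g_itv ab bag sab d0 eta0 CE ME.
have xi01 : 0 < xi < 1 / 2 by case/andP: xi_itv => *; apply/andP; split; lra.
have e1 := expRN1_ge R.
have C1 : 4 * expR (- 1) <= C.
  rewrite CE; case: ifP => // _.
  by rewrite ler_wpM2l// lerDl powR_ge0.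
have C2 r : 0 < r <= delta -> 1 < r -> 4 * r `^ (g + 1) <= C.
  move=> /andP[r0 rd] r1; rewrite CE (lt_le_trans r1 rd) ler_wpM2l//.
  apply: (@le_trans _ _ (delta `^ (g + 1))); last by rewrite lerDr expR_ge0.
  apply: ge0_ler_powR; rewrite ?nnegrE; case/andP: g_itv; lra.
have C0 : 0 < C.
  rewrite CE; case: ifP => _; last lra.
  have := powR_ge0 delta (g + 1); lra.
have rho01 := cheb_rate_itv xi_itv.
have sag : s <= a + g by case/andP: g_itv; case/andP: sab; case/andP: xi01; nra.
have bg : 2 * b <= a + g + s.
  by case/andP: g_itv; case/andP: sab; case/andP: xi01; nra.
rewrite -muleA; have [fin|] := ltP (gagliardo (a + g) u * gagliardo s v)%E +oo%E;
  last by rewrite leye_eq => /eqP ->; rewrite gt0_muley ?leey ?lte_fin.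
have order k : (M + 1 <= k%:Z) -> C * (1 / 8 * (xi^-1 - 2)) ^+ k <= eta.
  by rewrite ME subrK; exact: ceil_log_le.
case: M {ME} order => [M|M] order.
  rewrite /interp_form; apply: nonlocal_form_error => //; first exact: ltW.
    by move=> m; have /andP[_] := cheb_node_itv M m (ltW ab); lra.
  move=> r rd; have /andP[r0 _] := rd.
  apply: le_trans
    (interp_kernel_error M xi01 g_itv ab bag sab r0 C1 (C2 r rd)) _.
  rewrite ler_wpM2r ?expR_ge0// order//.
  by rewrite [X in _ <= X]intS addrC.
have Ceta : C <= eta.
  have := order 0%N; rewrite expr0 mulr1; apply.
  by rewrite NegzE addrC subr_le0.
(* a negative order: the empty combination approximates well enough *)
have := @nonlocal_form_error R n u v (a + g) s delta eta 0
  (fun=> 0) (fun=> 0) mu mv d0 (ltW eta0) sag.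
rewrite !big_ord0 /=; apply => //; first by case.
move=> r rd; have /andP[r0 _] := rd.
rewrite big_ord0 subr0 ger0_norm ?expR_ge0//.
have sa : a <= s <= a + g by case/andP: sab => -> _.
apply: le_trans (kernel_le_no_node sa r0 C1 (C2 r rd)) _.
by rewrite ler_wpM2r ?expR_ge0.
Qed.

Theorem lemma5p2 (R : realType) (smax delta xi eps0 lambda : R)
    (smax_lt1 : smax < 1) (delta_gt0 : 0 < delta)
    (xi_itv : 1 / 10 < xi < 1 / 2)
    (eps0_small : eps0 < Num.min (1 - smax) (1 / 2))
    (lambda_gt0 : 0 < lambda) :
  exists C : R, 0 < C /\
  forall (smin eps eta : R) (K : nat),
    0 < smin < smax -> 0 < eps <= eps0 -> 0 < eta ->
    last_index smin smax xi eps K ->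
    (forall (n : nat) (Omega : set 'rV[R]_n),
      (1 <= n)%N -> smooth_bounded_domain Omega ->
      forall (u : R -> 'rV[R]_n -> R) (s : R),
        smin <= s <= smax -> sobolev_on Omega (s + 1 / 2 - eps) (u s) ->
      forall k : nat, (1 <= k <= K)%N ->
        let a := s_min smin xi eps k in
        let b := s_max smin smax xi eps K k in
        a <= s <= b ->
      forall v : 'rV[R]_n -> R, sobolev_on Omega s v ->
        (`| nonlocal_form (u s) v s delta -
            interp_form a b (interp_order smin xi eps delta eta k)
              (u s) v s delta |%:E
         <= eta%:E * gagliardo (s2bar smin xi eps k) (u s) * gagliardo s v)%E) /\
    (lambda <= `| ln eta | ->
      \sum_(1 <= k < K.+1) ((interp_order smin xi eps delta eta k + 1)%:~R : R)
        <= C * `| ln eta |).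
Proof.
have [rho0 rho1] := andP (cheb_rate_itv xi_itv).
have xih : 0 < 1 / 2 - xi by case/andP: xi_itv; lra.
pose d := (1 / 2 - xi) * (Num.min (1 - smax) (1 / 2) - eps0).
have d0 : 0 < d by rewrite mulr_gt0// subr_gt0.
pose B := (1 + ln (4 * (expR (- 1) + delta ^+ 2)) / lambda) /
  - ln (1 / 8 * (xi^-1 - 2)) + lambda^-1.
have B0 : 0 < B.
  rewrite ltr_wpDl ?invr_gt0// divr_ge0//; last first.
    by rewrite oppr_ge0 ln_le0// ltW.
  rewrite addr_ge0// divr_ge0 ?ln_ge0 ?(ltW lambda_gt0)//.
  have := expRN1_ge R; have := sqr_ge0 delta; lra.
exists ((1 + d^-1) * B); split.
  by rewrite mulr_gt0// addr_gt0 ?invr_gt0.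
move=> smin eps eta K smin_itv eps_itv eta0 HK; split.
  move=> n Omega _ _ u s _ [Hu _] k kK a b sab v [Hv _].
  rewrite s2barE; apply: (interp_form_error _ _ xi_itv) => //.
  - exact: sobolev_measurable Hu.
  - exact: sobolev_measurable Hv.
  - exact: (g_itv smin_itv eps_itv eps0_small HK).
  - exact: (subinterval_lt xi_itv smin_itv eps_itv eps0_small HK).
  - exact: (subinterval_length HK).
move=> lae; rewrite -mulrA.
apply: (@le_trans _ _ (\sum_(1 <= k < K.+1) B * `|ln eta|)).
  by apply: ler_sum => k _; exact: (interp_order_le _ xi_itv eps_itv).
rewrite sumr_const_nat subSS subn0 -mulr_natl ler_wpM2r//.
  by rewrite mulr_ge0// ltW.
exact: (number_subintervals xi_itv smin_itv eps_itv eps0_small HK).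
Qed.
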